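(* Let $\varphi$ be a lower semicontinuous submeasure on $\mathbb{N}$ such that there are $M>0$ and an interval partition $\{I_n:n\in\mathbb{N}\}$ of $\mathbb{N}$ satisfying: (a) the family $\mathcal{B}=\{A\subseteq\mathbb{N}:\varphi(A)\leq M\}$ covers $\mathbb{N}$; (b) $\sup_n\varphi(I_n)=\infty$; and (c) $\varphi(B)=\sup\{\varphi(B\cap I_n):n\in\mathbb{N}\}$ for all $B\subseteq\mathbb{N}$. For each $n$ let $\mathcal{S}_n$ be a subfamily of $\mathcal{P}(I_n)\cap\mathcal{B}$ that covers $I_n$, let $\epsilon_n=\delta(I_n,\mathcal{S}_n)$ be its covering number, and let $\delta=\inf\{\epsilon_n:n\in\mathbb{N}\}$. If $\delta>0$, then (i) $\widehat{\varphi}$ is bounded; (ii) $P(\varphi)=\infty$; (iii) $\mathrm{FIN}(\varphi)$ is not contained in any nontrivial nonpathological $F_\sigma$ ideal, i.e. there is no nonpathological lower semicontinuous submeasure $\psi$ on $\mathbb{N}$ with $\mathrm{FIN}(\psi)\neq\mathcal{P}(\mathbb{N})$ and $\mathrm{FIN}(\varphi)\subseteq\mathrm{FIN}(\psi)$; and (iv) $\mathrm{FIN}(\varphi)$ is a pathological $F_\sigma$ ideal.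
   Context: A lower semicontinuous submeasure (lscsm) on $\mathbb{N}$ is a function $\varphi:\mathcal{P}(\mathbb{N})\to[0,\infty]$ with $\varphi(\emptyset)=0$, $\varphi(A)\leq\varphi(A\cup B)\leq\varphi(A)+\varphi(B)$ for all $A,B$, $\varphi(\{n\})<\infty$ for all $n$, and $\varphi(A)=\lim_{n\to\infty}\varphi(A\cap\{0,1,\dots,n\})$ for all $A$. Put $\mathrm{FIN}(\varphi)=\{A\subseteq\mathbb{N}:\varphi(A)<\infty\}$. A measure here is a $\sigma$-additive measure $\mu$ on $\mathcal{P}(\mathbb{N})$; it is dominated by $\varphi$ if $\mu(A)\leq\varphi(A)$ for all $A$. Define $\widehat{\varphi}(A)=\sup\{\mu(A):\mu\text{ is a measure dominated by }\varphi\}$. The lscsm $\varphi$ is nonpathological if $\varphi=\widehat{\varphi}$. The degree of pathology is $P(\varphi)=\sup\{\varphi(A)/\widehat{\varphi}(A):A\subseteq\mathbb{N}\text{ finite},\ \widehat{\varphi}(A)\neq0\}$. An $F_\sigma$ ideal $\mathcal{I}$ on $\mathbb{N}$ is nonpathological if $\mathcal{I}=\mathrm{FIN}(\varphi)$ for some nonpathological lscsm $\varphi$, and pathological otherwise. Ideals are proper ($\mathbb{N}\notin\mathcal I$) and contain all finite sets; $F_\sigma$ refers to the topology of $2^{\mathbb{N}}$. An interval partition of $\mathbb{N}$ is a family $\{I_n:n\in\mathbb{N}\}$ of (nonempty finite) intervals of $\mathbb{N}$ with $\min I_0=0$ and $\min I_{n+1}=\max I_n+1$. For a nonempty finite set $K$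 and a family $\mathcal{S}$ of subsets of $K$ covering $K$, let $m(K,\mathcal{S})=\min_{i\in K}|\{s\in\mathcal{S}:i\in s\}|$; the covering number is $\delta(K,\mathcal{S})=m(K,\mathcal{S})/|\mathcal{S}|$. *)

(* Defs.v *)
From HB Require Import structures.
From mathcomp Require Import all_boot all_order all_algebra finmap.
From mathcomp Require Import all_classical all_reals all_analysis.
From mathcomp Require Import borel_hierarchy.

Set Implicit Arguments.
Unset Strict Implicit.
Unset Printing Implicit Defensive.

Import Order.TTheory GRing.Theory Num.Theory.
Import numFieldNormedType.Exports.

Local Open Scope classical_set_scope.
Local Open Scope ring_scope.

Section submeasures.
Context {R : realType}.
Local Open Scope ereal_scope.
Implicit Types (phi psi : set nat -> \bar R) (A B : set nat).

(* `I_n.+1 is {0, ..., n} *)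
Record lscsm phi : Prop := Lscsm {
  lscsm_ge0 : forall A, 0 <= phi A ;
  lscsm_set0 : phi set0 = 0 ;
  lscsm_mono : forall A B, phi A <= phi (A `|` B) ;
  lscsm_subadd : forall A B, phi (A `|` B) <= phi A + phi B ;
  lscsm_set1_fin : forall n : nat, phi [set n] < +oo ;
  lscsm_lim : forall A, phi (A `&` `I_n.+1) @[n --> \oo] --> phi A }.

Definition FIN phi : set (set nat) := [set A | phi A < +oo].

(* Every subset of nat is measurable for the canonical structure on nat, so
   {measure set nat -> \bar R} is the type of sigma-additive measures on the
   whole power set. *)
Definition dominated phi (mu : {measure set nat -> \bar R}) : Prop :=
  forall A, mu A <= phi A.

Definition hat phi A : \bar R :=
  ereal_sup [set mu A | mu in [set mu | dominated phi mu]].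

Definition nonpathological phi : Prop := phi = hat phi.

Definition degree_of_pathology phi : \bar R :=
  ereal_sup [set phi A / hat phi A | A in
    [set A : set nat | finite_set A /\ hat phi A != 0]].

End submeasures.

Record is_ideal (I : set (set nat)) : Prop := IsIdeal {
  ideal_sub : forall A B, A `<=` B -> I B -> I A ;
  ideal_setU : forall A B, I A -> I B -> I (A `|` B) ;
  ideal_finite : forall A, finite_set A -> I A ;
  ideal_proper : ~ I setT }.

(* The topology of the Cantor space is transported along characteristic
   functions. *)
Definition Fsigma_ideal (I : set (set nat)) : Prop :=
  is_ideal I /\ Fsigma [set x : cantor_space | I [set n | x n]].

Definition pathological_Fsigma_ideal (R : realType) (I : set (set nat)) : Prop :=
  Fsigma_ideal I /\
  ~ exists psi : set nat -> \bar R,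
      [/\ lscsm psi, nonpathological psi & I = FIN psi].

(* a n and b n are the minimum and the maximum of I n *)
Definition interval_partition (I : nat -> set nat) : Prop :=
  exists a b : nat -> nat,
    [/\ forall n, (a n <= b n)%N,
        forall n, I n = [set k | (a n <= k <= b n)%N],
        a 0%N = 0%N &
        forall n, a n.+1 = (b n).+1].

(* Meaningful for K finite and nonempty, and S a family of subsets of K. The
   neutral element #|S| bounds all the cardinals in the minimum, so it does not
   affect it. Note that fset_set sends infinite sets to fset0. *)
Definition min_cover (K : set nat) (S : set (set nat)) : nat :=
  \big[minn/#|` fset_set S|%N]_(i <- fset_set K)
     #|` fset_set [set s | S s /\ s i] |%N.

Definition covering_number {R : realType} (K : set nat) (S : set (set nat)) : R :=
  (min_cover K S)%:R / (#|` fset_set S|)%:R.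

(* Main.v *)
Require Import Defs.
From HB Require Import structures.
From mathcomp Require Import all_boot all_order all_algebra finmap.
From mathcomp Require Import all_classical all_reals all_analysis.
From mathcomp Require Import borel_hierarchy.

(** The family S n covers every point of I n at least a fraction delta of the
    time, so for each measure mu some member s of S n satisfies
    delta * mu (I n) <= mu s (lemma covering_number_pigeonhole).  Such a member
    can be chosen in every interval at once, and even for a measure that varies
    with n.  Since phi is the supremum of its values on the I n, the union of
    the chosen sets has phi-value at most M, although it captures the fraction
    delta of the mass on every interval (lemma large_selector).

    For one measure mu dominated by phi, this union U gives
    delta * mu setT <= mu U <= phi U <= M.  So hat phi is bounded by M / delta.
    It is positive on any interval that is not phi-null, because of point
    masses, whereas phi (I n) is unbounded; hence the degree of pathology is
    infinite.

    Let now psi be nonpathological with psi setT = +oo.  Since psi is finite on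
    finite sets and lower semicontinuous, beyond any cut point there is a
    finite block of intervals with psi-value as large as desired, witnessed by
    a measure dominated by psi.  Iterating gives disjoint consecutive blocks
    D 0, D 1, ... and measures nu k giving the union of D k mass above k.  The selector that
    follows nu k on D k has a union U in FIN phi, while psi U >= delta * k for
    all k; so FIN phi is not contained in FIN psi (lemma
    FIN_not_sub_nonpathological).

    Finally FIN phi is F_sigma, because by lower semicontinuity each sublevel
    set of phi is defined by conditions on finitely many coordinates at a time,
    hence is closed; that it is pathological is the case FIN psi = FIN phi of
    the previous paragraph. *)

Set Implicit Arguments.
Unset Strict Implicit.
Unset Printing Implicit Defensive.

Import Order.TTheory GRing.Theory Num.Theory.
Import numFieldNormedType.Exports.

Local Open Scope classical_set_scope.
Local Open Scope ring_scope.

(** * Submeasures and their F_sigma ideals *)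

Section Submeasures.
Context {R : realType}.
Local Open Scope ereal_scope.
Implicit Types (phi psi : set nat -> \bar R) (A B K : set nat).

Lemma lscsm_le phi A B : lscsm phi -> A `<=` B -> phi A <= phi B.
Proof. by move=> h /setUidPr <-; exact: lscsm_mono. Qed.

Lemma lscsm_finite phi A : lscsm phi -> finite_set A -> phi A < +oo.
Proof.
move=> h /finite_fsetP[X ->]; elim/finSet_rect: X => X IH.
have [->|[x xX]] := fset_0Vmem X.
  by rewrite set_fset0 lscsm_set0.
rewrite -(fsetD1K xX) set_fsetU1.
apply: (le_lt_trans (lscsm_subadd h _ _)).
by rewrite lte_add_pinfty ?lscsm_set1_fin// IH// fproperD1.
Qed.

(** Lower semicontinuity in the form used below: a bound on the finite initial
    parts of a set passes to the limit. *)
Lemma lscsm_leP phi A (x : \bar R) : lscsm phi ->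
  (forall n, phi (A `&` `I_n.+1) <= x) -> phi A <= x.
Proof.
move=> h Ax; apply: (@cvge_le _ \oo _ R (fun n => phi (A `&` `I_n.+1)) (phi A) x).
  by near=> n; exact: Ax.
exact: lscsm_lim.
Unshelve. all: by end_near. Qed.

Lemma FIN_is_ideal phi : lscsm phi -> phi setT = +oo -> is_ideal (FIN phi).
Proof.
move=> h phiT; split.
- by move=> A B AB; apply: le_lt_trans; exact: lscsm_le.
- move=> A B Afin Bfin; apply: (le_lt_trans (lscsm_subadd h _ _)).
  exact: lte_add_pinfty.
- by move=> A; exact: lscsm_finite.
- by rewrite /FIN /= phiT ltxx.
Qed.

(** FIN phi is the union over k of the sublevel sets {phi <= k}.  If phi exceeds
    k at a set, it already does so at a finite initial part of it, which is
    shared by all sets of a basic neighbourhood; so {phi <= k} is closed. *)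
Lemma FIN_Fsigma phi : lscsm phi ->
  Fsigma [set x : cantor_space | FIN phi [set n | x n]].
Proof.
move=> h.
exists (fun k => [set x : cantor_space | phi [set n | x n] <= k%:R%:E]); last first.
  rewrite /FIN/=; apply/seteqP; split => x /=.
    have := lscsm_ge0 h [set n | x n].
    case Ex: (phi [set n | x n]) => [r| |//] // r0 _.
    by exists (Num.bound r) => //=; rewrite Ex lee_fin ltW// archi_boundP.
  by move=> [k _ /= /le_lt_trans->//]; rewrite ltry.
move=> k; rewrite -openC openE => x /= /negP; rewrite -ltNge => kx.
have [N kN] : exists N, k%:R%:E < phi ([set n | x n] `&` `I_N.+1).
  apply: contrapT => /forallNP le_k; move: kx; rewrite ltNge => /negP; apply.
  by apply: lscsm_leP => // n; rewrite leNgt; apply/negP; exact: le_k.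
have near_x (i : 'I_N.+1) : nbhs x [set y : cantor_space | y i = x i].
  apply: (@proj_continuous nat (fun=> bool) i x [set b | b = x i]).
  exact: discrete_set1.
apply: filterS (filter_forall _ near_x) => y yx /=; apply/negP; rewrite -ltNge.
apply: (lt_le_trans kN); apply: lscsm_le => // n [/= xn nN].
by rewrite (yx (Ordinal nN)).
Qed.
End Submeasures.

(** * Averaging over a cover *)

Lemma mem_max_seq d (T : orderType d) (I : eqType) (F : I -> T) (r : seq I) :
  r != [::] -> exists2 x, x \in r & forall y, y \in r -> (F y <= F x)%O.
Proof.
elim: r => // a [|b r] IH _.
  by exists a => [|y]; rewrite mem_seq1// => /eqP->.
have [//|x xr xmax] := IH.
have [ax|xa] := leP (F a) (F x).
  exists x; first by rewrite in_cons xr orbT.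
  by move=> y; rewrite in_cons => /predU1P[->//|/xmax].
exists a; first by rewrite mem_head.
move=> y; rewrite in_cons => /predU1P[->//|/xmax yx].
exact: le_trans yx (ltW xa).
Qed.

Lemma finite_family (K : set nat) (S : set (set nat)) :
  finite_set K -> (forall s, S s -> s `<=` K) -> finite_set S.
Proof.
move=> finK SK.
have := finite_image (fun X : {fset nat} => [set` X]) (finite_fset (fpowerset (fset_set K))).
apply: sub_finite_set => s Ss /=.
have fins : finite_set s := sub_finite_set (SK _ Ss) finK.
exists (fset_set s); last by rewrite fset_setK.
by rewrite fpowersetE; apply/fsubsetP => i; rewrite !in_fset_set// !inE; exact: SK.
Qed.

Lemma min_cover_le (K : set nat) (S : set (set nat)) i : finite_set K -> K i ->
  (min_cover K S <= #|` fset_set [set s | S s /\ s i]|)%N.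
Proof.
move=> finK Ki; rewrite /min_cover.
have : i \in (fset_set K : seq nat) by rewrite in_fset_set// inE.
elim: (fset_set K : seq nat) => // j r IH.
rewrite in_cons big_cons => /predU1P[<-|/IH]; first exact: geq_minl.
by move=> Hr; rewrite (leq_trans _ Hr)// geq_minr.
Qed.

Section Averaging.
Context {R : realType}.
Local Open Scope ereal_scope.
Implicit Types (mu : {measure set nat -> \bar R}) (s K : set nat) (S : set (set nat)).

Lemma sume_const_seq (T : Type) (r : seq T) (x : \bar R) : 0 <= x ->
  \sum_(i <- r) x = (size r)%:R%:E * x.
Proof.
move=> x0; elim: r => [|a r IH]; first by rewrite big_nil mul0e.
by rewrite big_cons IH/= -add1n natrD EFinD ge0_muleDl// mul1e.
Qed.

Lemma measure_sum_points mu K s : finite_set K -> s `<=` K ->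
  mu s = \sum_(i <- fset_set K) mu (s `&` [set i]).
Proof.
move=> finK sK; rewrite -fsbig_finite// -measure_fin_bigcup//.
  congr (mu _); apply/seteqP; split => [i si|i [j _ []//]].
  by exists i => //; exact: sK.
by move=> i j _ _ [x [[_ /= <-] [_ /= <-]]].
Qed.

(** Double counting: in the sum of mu s over s in S, the mass of each point of K
    is counted once for each member of S that contains it. *)
Lemma min_cover_measure_le mu K S : finite_set K -> (forall s, S s -> s `<=` K) ->
  (min_cover K S)%:R%:E * mu K <= \sum_(s <- fset_set S) mu s.
Proof.
move=> finK SK; have finS := finite_family finK SK.
rewrite [leRHS](eq_big_seq (fun s => \sum_(i <- fset_set K) mu (s `&` [set i]))); last first.
  by move=> s; rewrite in_fset_set// inE => Ss; apply: measure_sum_points => //; exact: SK.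
rewrite exchange_big /= (measure_sum_points mu finK (@subset_refl _ K)).
rewrite ge0_sume_distrr//.
rewrite big_seq [leRHS]big_seq; apply: lee_sum => i; rewrite in_fset_set// inE => Ki.
have finSi : finite_set [set s | S s /\ s i] by apply: sub_finite_set finS => s [].
apply: (@le_trans _ _ (\sum_(s <- fset_set [set s | S s /\ s i]) mu (s `&` [set i]))); last first.
  apply: lee_sum_nneg_subfset => //.
  by move=> s; rewrite !in_fset_set// !inE => -[].
rewrite (eq_big_seq (fun=> mu [set i])); last first.
  move=> s; rewrite in_fset_set// inE => -[_ si].
  by congr (mu _); apply/setIidPr => _ ->.
have -> : K `&` [set i] = [set i] by apply/setIidPr => _ ->.
rewrite sume_const_seq//.
by apply: lee_wpmul2r => //; rewrite lee_fin ler_nat; exact: min_cover_le.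
Qed.

(** The average of mu s over s in S is at least covering_number K S * mu K, so
    the member of largest measure reaches this value.  As the argument bounds
    the average by a maximum, it also covers the case mu K = +oo. *)
Lemma covering_number_pigeonhole mu K S :
    finite_set K -> S !=set0 -> (forall s, S s -> s `<=` K) ->
  exists2 s, S s & (covering_number K S : R)%:E * mu K <= mu s.
Proof.
move=> finK [s0 Ss0] SK; have finS := finite_family finK SK.
have s0S : s0 \in fset_set S by rewrite in_fset_set// inE.
have [|s sS smax] := @mem_max_seq _ _ _ mu (fset_set S : seq (set nat)).
  by apply: contraTneq s0S => S0; rewrite -[_ \in _]/(s0 \in (fset_set S : seq _)) S0.
exists s; first by move: sS; rewrite in_fset_set// inE.
have S_gt0 : (0 < #|` fset_set S|%:R :> R)%R.
  by rewrite ltr0n cardfs_gt0; apply/fset0Pn; exists s0.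
rewrite /covering_number mulrC EFinM -muleA lee_pdivrMl//.
apply: (le_trans (min_cover_measure_le mu finK SK)).
rewrite big_seq; apply: (@le_trans _ _ (\sum_(t <- fset_set S | t \in fset_set S) mu s)).
  by apply: lee_sum => t; exact: smax.
by rewrite -big_seq sume_const_seq.
Qed.

End Averaging.

(** * Interval partitions *)

Section IntervalPartition.
Context (I : nat -> set nat) (I_part : interval_partition I).

Lemma interval_partition_finite n : finite_set (I n).
Proof.
have [a [b [_ IE _ _]]] := I_part; rewrite IE.
apply: (@sub_finite_set _ _ `I_(b n).+1) => [k /= /andP[_]|]; first by rewrite ltnS.
exact: finite_II.
Qed.

Lemma interval_partition_neq0 n : I n !=set0.
Proof. by have [a [b [ab IE _ _]]] := I_part; exists (a n); rewrite IE /= leqnn ab. Qed.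

Lemma interval_partition_trivIset : trivIset setT I.
Proof.
have [a [b [ab IE _ ba]]] := I_part.
have sep i j : (i < j)%N -> (b i < a j)%N.
  elim: j => // j IHj; rewrite ltnS ba ltnS leq_eqVlt => /predU1P[->//|/IHj bi].
  by rewrite (leq_trans (ltnW bi)).
move=> i j _ _; rewrite !IE => -[x [/= /andP[ai ib] /andP[aj jb]]].
have [/sep|/sep|//] := ltngtP i j.
  by rewrite ltnNge (leq_trans aj ib).
by rewrite ltnNge (leq_trans ai jb).
Qed.

(** The bound on n holds since nonempty consecutive intervals satisfy
    n <= min (I n); it makes finitely many intervals cover an initial segment. *)
Lemma interval_partition_cover_le j : exists2 n, (n <= j)%N & I n j.
Proof.
have [a [b [ab IE a0 ba]]] := I_part.
elim: j => [|j [n nj]]; first by exists 0%N; rewrite ?IE /= ?a0.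
rewrite IE /= => /andP[aj jb]; have [jb'|bj] := ltnP j (b n).
  by exists n; [exact: leqW|rewrite IE /= (leqW aj)].
have bE : b n = j by apply/eqP; rewrite eqn_leq bj.
by exists n.+1; rewrite // IE /= ba bE leqnn (leq_trans _ (ab n.+1))// ba bE.
Qed.

Lemma interval_partition_cover : \bigcup_n I n = setT.
Proof. by rewrite -subTset => j _; have [n _ Inj] := interval_partition_cover_le j; exists n. Qed.

End IntervalPartition.

(** * Choosing one set in each interval *)

Section Selectors.
Context {R : realType} (I : nat -> set nat) (I_triv : trivIset setT I).
Local Open Scope ereal_scope.
Implicit Types (s : nat -> set nat).

(** A union of sets chosen inside the disjoint sets I n meets each I n in the
    chosen set only, so phi of the union is the supremum of the chosen values. *)
Lemma selector_bounded (phi : set nat -> \bar R) (M : \bar R) s :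
    (forall B, phi B = ereal_sup (range (fun n => phi (B `&` I n)))) ->
    (forall n, s n `<=` I n /\ phi (s n) <= M) ->
  phi (\bigcup_n s n) <= M.
Proof.
move=> phi_sup sP; rewrite phi_sup; apply: ge_ereal_sup => _ [n _ <-].
suff -> : \bigcup_i s i `&` I n = s n by have [] := sP n.
apply/seteqP; split => [x [[i _ six] Inx]|x snx].
  rewrite -(I_triv (i := i) (j := n))//.
  by exists x; split => //; have [+ _] := sP i; exact.
by split; [exists n|have [+ _] := sP n; exact].
Qed.

Lemma selector_measure (mu : {measure set nat -> \bar R}) (d : R) (D : set nat) s :
    (0 <= d)%R -> (forall n, s n `<=` I n) ->
    (forall n, D n -> d%:E * mu (I n) <= mu (s n)) ->
  d%:E * mu (\bigcup_(n in D) I n) <= mu (\bigcup_(n in D) s n).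
Proof.
move=> d0 sI ds.
have s_triv : trivIset D s.
  by move=> i j _ _ [x [/sI six /sI sjx]]; apply: I_triv => //; exists x.
rewrite !measure_bigcup//; last exact: sub_trivIset I_triv.
rewrite -nneseriesZl//; apply: lee_nneseries => n; last by rewrite inE; exact: ds.
by move=> _ _; rewrite mule_ge0// lee_fin.
Qed.
End Selectors.

(** * Measures dominated by a submeasure *)

Section Hat.
Context {R : realType}.
Local Open Scope ereal_scope.
Implicit Types (phi psi : set nat -> \bar R) (A B K : set nat).

Lemma measure_mono (mu : {measure set nat -> \bar R}) A B : A `<=` B -> mu A <= mu B.
Proof. by move=> AB; apply: le_measure => //; rewrite inE. Qed.

(** By subadditivity some point i of K has phi [set i] > 0, and the point mass
    phi [set i] at i is a measure dominated by phi. *)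
Lemma hat_gt0 phi K : lscsm phi -> finite_set K -> 0 < phi K -> 0 < hat phi K.
Proof.
move=> h finK phiK.
have [i [Ki phi_i]] : exists i, K i /\ 0 < phi [set i].
  apply: contrapT => /forallNP null; move: phiK; rewrite ltNge => /negP; apply.
  move: null; have /finite_fsetP[X ->] := finK; elim/finSet_rect: X => X IH null.
  have [->|[x xX]] := fset_0Vmem X; first by rewrite set_fset0 lscsm_set0.
  rewrite -(fsetD1K xX) set_fsetU1 (le_trans (lscsm_subadd h _ _))//.
  rewrite -[leRHS]adde0 leeD//.
    by rewrite leNgt; apply/negP => phix; apply: (null x).
  apply: IH; first exact: fproperD1.
  by move=> y [/= yX phiy]; apply: (null y); split => //; move: yX; rewrite !inE => /andP[].
have phi_fin : phi [set i] \is a fin_num.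
  by rewrite ge0_fin_numE ?lscsm_set1_fin// lscsm_ge0.
have c0 : (0 <= fine (phi [set i]))%R by rewrite fine_ge0// lscsm_ge0.
pose mu : {measure set nat -> \bar R} := mscale (NngNum c0) (dirac i : {measure set nat -> \bar R}).
have muE A : mu A = phi [set i] * (\1_A i)%:E.
  by rewrite /mu/= /mscale/= diracE/= fineK.
apply: (@lt_le_trans _ _ (mu K)).
  by rewrite muE indicE mem_set// mule1.
apply: ereal_sup_ubound; exists mu => // A; rewrite muE indicE.
case: (boolP (i \in A)) => [|_]; last by rewrite mule0 lscsm_ge0.
by rewrite inE => Ai; rewrite mule1; apply: lscsm_le => // _ ->.
Qed.

(** The intervals before m form a finite set, on which psi is finite, so psi is
    infinite on the rest; lower semicontinuity then leaves a value above r on a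
    finite part of it, and nonpathology realizes this value by a measure. *)
Lemma nonpathological_tail_measure psi (I : nat -> set nat) (m : nat) (r : R) :
    lscsm psi -> nonpathological psi -> psi setT = +oo -> interval_partition I ->
  exists mu : {measure set nat -> \bar R}, exists m' : nat, dominated psi mu /\
    r%:E < mu (\bigcup_(n in [set n | m <= n < m']%N) I n).
Proof.
move=> h np psiT I_part.
have head_fin : psi (\bigcup_(n in `I_m) I n) < +oo.
  apply: lscsm_finite => //; apply: bigcup_finite => [|n _]; first exact: finite_II.
  exact: interval_partition_finite.
pose T := \bigcup_(n in [set n | m <= n]%N) I n.
have psiTy : psi T = +oo.
  apply/eqP; rewrite -leye_eq leNgt; apply/negP => tail_fin.
  suff : psi setT < +oo by rewrite psiT ltxx.
  apply: le_lt_trans (lte_add_pinfty head_fin tail_fin).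
  apply: le_trans (lscsm_subadd h _ _); apply: lscsm_le => // j _.
  have : setT j by []; rewrite -(interval_partition_cover I_part) => -[n _ Inj].
  by have [nm|mn] := ltnP n m; [left|right]; exists n.
have [N rN] : exists N, r%:E < psi (T `&` `I_N.+1).
  apply: contrapT => /forallNP le_r.
  suff : psi T <= r%:E by rewrite psiTy leye_eq.
  by apply: lscsm_leP => // n; rewrite leNgt; apply/negP; exact: le_r.
have : r%:E < hat psi (T `&` `I_N.+1) by rewrite -np.
move=> /ereal_sup_gt[_ [mu mu_dom <-] rmu].
exists mu, N.+1; split => //; apply: (lt_le_trans rmu); apply: measure_mono.
move=> j [[n /= mn Inj] /= jN].
have [n' n'j In'j] := interval_partition_cover_le I_part j.
exists n => //=; rewrite mn /=.
rewrite (interval_partition_trivIset I_part (i := n) (j := n'))//; last by exists j.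
by rewrite (leq_ltn_trans n'j).
Qed.

End Hat.

(** * Submeasures with uniformly large covers *)

Section Covering.
Context {R : realType} (phi : set nat -> \bar R) (M : R) (I : nat -> set nat)
  (S : nat -> set (set nat)) (d : R) (I_part : interval_partition I)
  (phi_sup : forall B : set nat,
    phi B = ereal_sup (range (fun n => phi (B `&` I n))))
  (S_sub : forall n s, S n s -> s `<=` I n /\ (phi s <= M%:E)%E)
  (d_gt0 : 0 < d)
  (S_large : forall n (mu : {measure set nat -> \bar R}),
    exists2 s, S n s & (d%:E * mu (I n) <= mu s)%E).
Local Open Scope ereal_scope.
Implicit Types (psi : set nat -> \bar R) (A : set nat).

(** The measure may change with the interval: this freedom is what the diagonal
    argument against nonpathological submeasures uses. *)
Lemma large_selector (mu : nat -> {measure set nat -> \bar R}) :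
  exists s : nat -> set nat, [/\ forall n, s n `<=` I n,
    forall n, d%:E * mu n (I n) <= mu n (s n) & phi (\bigcup_n s n) <= M%:E].
Proof.
have ex n : exists s, S n s /\ d%:E * mu n (I n) <= mu n s.
  by have [s] := S_large n (mu n); exists s.
have [s sP] := choice ex; exists s; split => [n|n|].
- by have [/S_sub[]] := sP n.
- by have [] := sP n.
apply: (selector_bounded (interval_partition_trivIset I_part) phi_sup) => n.
by apply: S_sub; have [] := sP n.
Qed.

(** A selector that follows mu on every interval captures the fraction d of the
    total mass of mu inside a set of phi-value at most M. *)
Lemma hat_bounded A : hat phi A <= (d^-1 * M)%:E.
Proof.
apply: ge_ereal_sup => _ [mu mu_dom <-].
apply: le_trans (measure_mono mu (@subsetT _ A)) _.
rewrite EFinM -lee_pdivrMl ?invr_gt0// invrK -(interval_partition_cover I_part).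
have [s [sI s_large s_le]] := large_selector (fun=> mu).
apply: le_trans s_le; apply: le_trans (mu_dom _).
apply: selector_measure (ltW d_gt0) sI _ => //.
exact: interval_partition_trivIset.
Qed.

(** A gliding hump: consecutive blocks of intervals carry measures nu k dominated
    by psi, of mass more than k, and the selector that follows nu k on the k-th
    block has a union which is small for phi and of infinite psi-value. *)
Lemma FIN_not_sub_nonpathological psi : lscsm psi -> nonpathological psi ->
  psi setT = +oo -> ~ (FIN phi `<=` FIN psi).
Proof.
move=> psi_lscsm np psiT FIN_sub.
have ex (x : nat * nat) : exists y : {measure set nat -> \bar R} * nat,
    dominated psi y.1 /\
    x.2%:R%:E < y.1 (\bigcup_(n in [set n | x.1 <= n < y.2]%N) I n).
  have [mu [m' ?]] :=
    nonpathological_tail_measure x.1 x.2%:R psi_lscsm np psiT I_part.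
  by exists (mu, m').
have [next nextP] := choice ex.
pose cut := fix cut k := if k is k'.+1 then (next (cut k', k')).2 else 0%N.
pose nu k := (next (cut k, k)).1.
pose D k := [set n | cut k <= n < cut k.+1]%N.
have nu_dom k : dominated psi (nu k) by have [] := nextP (cut k, k).
have nu_gt k : k%:R%:E < nu k (\bigcup_(n in D k) I n).
  by have [_] := nextP (cut k, k).
have cut_lt k : (cut k < cut k.+1)%N.
  rewrite ltnNge; apply/negP => le_cut; have := nu_gt k.
  suff -> : D k = set0 by rewrite bigcup_set0 measure0 lte_fin ltrn0.
  by rewrite -subset0 => n /= /andP[/(leq_trans le_cut)]; rewrite ltnNge => ->.
have cut_le i j : (i <= j)%N -> (cut i <= cut j)%N.
  by apply: (homo_leq (r := leq)) => // [? ? ?|k]; [exact: leq_trans|exact: ltnW].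
(* The blocks are disjoint, so each interval follows a single measure. *)
have D_uniq i j n : D i n -> D j n -> i = j.
  wlog lt_ij : i j / (i < j)%N => [H Di Dj|/andP[_ ni] /andP[jn _]].
    have [lt_ij|lt_ji|//] := ltngtP i j; first exact: H.
    by apply/esym; apply: H.
  by have := leq_trans ni (leq_trans (cut_le _ _ lt_ij) jn); rewrite ltnn.
pose block n := xget 0%N [set k | D k n].
have blockE k n : D k n -> block n = k.
  by move=> Dkn; apply: xget_subset1 => // i j; exact: D_uniq.
have [s [sI s_large s_le]] := large_selector (fun n => nu (block n)).
have : FIN psi (\bigcup_n s n) by apply: FIN_sub; exact: le_lt_trans s_le (ltry _).
apply/negP; rewrite -leNgt leye_eq; apply/eqP/eqyP => r r_gt0.
(* The mass k of the hump is reduced by the factor d, so k has to exceed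
   r / d. *)
pose k := Num.bound (d^-1 * r)%R.
apply: le_trans (nu_dom k _).
apply: (@le_trans _ _ (nu k (\bigcup_(n in D k) s n))); last first.
  by apply: measure_mono; exact: bigcup_subset.
apply: (@le_trans _ _ (d%:E * nu k (\bigcup_(n in D k) I n))); last first.
  apply: selector_measure (ltW d_gt0) sI _.
    exact: interval_partition_trivIset.
  by move=> n /blockE <-; exact: s_large.
rewrite -lee_pdivrMl// (le_trans _ (ltW (nu_gt k)))// -EFinM lee_fin ltW//.
by rewrite archi_boundP// mulr_ge0// ?invr_ge0 ltW.
Qed.

End Covering.

Theorem theorem3p8 (R : realType) (phi : set nat -> \bar R) (M : R)
    (I : nat -> set nat) (S : nat -> set (set nat))
    (phi_lscsm : lscsm phi) (M_gt0 : 0 < M) (I_part : interval_partition I)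
    (B_cover : \bigcup_(A in [set A | (phi A <= M%:E)%E]) A = [set: nat])
    (I_unbounded : ereal_sup (range (fun n => phi (I n))) = +oo%E)
    (phi_sup : forall B : set nat,
       phi B = ereal_sup (range (fun n => phi (B `&` I n))))
    (S_sub : forall n s, S n s -> s `<=` I n /\ (phi s <= M%:E)%E)
    (S_cover : forall n, I n `<=` \bigcup_(s in S n) s)
    (delta_gt0 : 0 < inf (range (fun n => covering_number (I n) (S n) : R))) :
  [/\ exists C : R, forall A : set nat, (hat phi A <= C%:E)%E,
      degree_of_pathology phi = +oo%E,
      ~ exists psi : set nat -> \bar R,
          [/\ lscsm psi, nonpathological psi, FIN psi <> [set: set nat] &
              FIN phi `<=` FIN psi] &
      pathological_Fsigma_ideal R (FIN phi)].
Proof.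
set delta := inf _ in delta_gt0.
have S_large n (mu : {measure set nat -> \bar R}) :
    exists2 s, S n s & (delta%:E * mu (I n) <= mu s)%E.
  have Sn0 : S n !=set0.
    have [i /S_cover[s Sns _]] := interval_partition_neq0 I_part n.
    by exists s.
  have [s Sns s_large] := covering_number_pigeonhole mu
    (interval_partition_finite I_part n) Sn0 (fun s Sns => (S_sub n s Sns).1).
  exists s => //; apply: le_trans s_large; apply: lee_wpmul2r => //.
  rewrite lee_fin; apply: ge_inf; last by exists n.
  by exists 0 => _ [k _ <-]; rewrite /covering_number divr_ge0.
have hat_le := hat_bounded I_part phi_sup S_sub delta_gt0 S_large.
have phiT : phi setT = +oo%E.
  apply/eqP; rewrite -leye_eq -I_unbounded; apply: ge_ereal_sup => _ [n _ <-].
  exact: lscsm_le.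
have no_psi : ~ exists psi : set nat -> \bar R,
    [/\ lscsm psi, nonpathological psi, FIN psi <> [set: set nat] &
        FIN phi `<=` FIN psi].
  move=> [psi [psi_lscsm np proper FIN_sub]].
  have psiT : psi setT = +oo%E.
    apply/eqP; rewrite -leye_eq leNgt; apply/negP => psiT; apply: proper.
    rewrite -subTset => A _; rewrite /FIN /=; apply: le_lt_trans psiT.
    exact: lscsm_le.
  exact: (FIN_not_sub_nonpathological I_part phi_sup S_sub delta_gt0 S_large
    psi_lscsm np psiT FIN_sub).
split => //.
- by exists (delta^-1 * M).
- apply/eqyP => r r_gt0.
  have C_gt0 : 0 < delta^-1 * M by rewrite mulr_gt0 ?invr_gt0.
  have [_ [n _ <-] phiIn] : exists2 x, range (fun n => phi (I n)) x &
      ((r * (delta^-1 * M))%:E < x)%E.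
    by apply: ereal_sup_gt; rewrite I_unbounded ltry.
  have phiIn_gt0 : (0 < phi (I n))%E.
    by apply: le_lt_trans phiIn; rewrite lee_fin mulr_ge0// ltW.
  have finIn := interval_partition_finite I_part n.
  have hat_In := hat_gt0 phi_lscsm finIn phiIn_gt0.
  apply: (@le_trans _ _ (phi (I n) / hat phi (I n))%E); last first.
    by apply: ereal_sup_ubound; exists (I n) => //=; split => //; rewrite gt_eqF.
  have hat_fin : hat phi (I n) \is a fin_num.
    by rewrite ge0_fin_numE ?(le_lt_trans (hat_le _))// ?ltry// ltW.
  move: (hat_le (I n)) hat_In; rewrite -(fineK hat_fin) lee_fin lte_fin.
  set c := fine _ => c_le c_gt0.
  rewrite inver gt_eqF// lee_pdivlMr// -EFinM.
  by apply: le_trans (ltW phiIn); rewrite lee_fin ler_wpM2l// ltW.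
- split; last first.
    move=> [psi [psi_lscsm np E]]; apply: no_psi; exists psi; split => //.
      rewrite -E => FINT; have : FIN phi setT by rewrite FINT.
      by rewrite /FIN/= phiT ltxx.
    by rewrite E.
  by split; [exact: FIN_is_ideal|exact: FIN_Fsigma].
Qed.
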